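(* Let $\kappa$ be an infinite cardinal and let $\lambda > \kappa^+$ be a regular cardinal. Suppose that the coloring $c : [\lambda]^2 \to 2$ witnesses the relation $\mathrm{Col}(\lambda,\kappa)$. Let $H_\kappa[c]$ denote the $\kappa$-closure of the set $F[c]$ in the Cantor cube $2^\lambda$. Then for every right separated subset $S$ of $H_\kappa[c]$ there is an $\alpha < \lambda$ for which $$\bigcup \{\operatorname{supp}(x) : x \in S\} \subset \alpha\,.$$
   Context: For infinite cardinals $\lambda,\kappa$, a coloring $c : [\lambda]^2 \to 2$ witnesses $\mathrm{Col}(\lambda,\kappa)$ if: given any ordinal $\xi < \kappa^+$ and any map $h : \xi\times\xi \to 2$, for every family $\{A_\alpha : \alpha < \lambda\}$ of $\lambda$ many pairwise disjoint subsets of $\lambda$ of order type $\xi$ there are $\alpha < \beta < \lambda$ such that $c(a_{\alpha,i},a_{\beta,j}) = h(i,j)$ for all $\langle i,j\rangle \in \xi\times\xi$, where $a_{\alpha,i}$ denotes the $i$th member of $A_\alpha$ in its increasing ordering. Here $c(\alpha,\beta)$ abbreviates $c(\{\alpha,\beta\})$. For a coloring $c : [\lambda]^2\to 2$, put $F[c] = \{c_\alpha : \alpha<\lambda\} \subset 2^\lambda$, where $c_\alpha \in 2^\lambda$ is defined by $c_\alpha(\beta) = c(\alpha,\beta)$ if $\beta<\alpha$, $c_\alpha(\alpha) = 1$, and $c_\alpha(\beta) = 0$ if $\beta > \alpha$. The Cantor cube $2^\lambda$ carries the product topology (with $2=\{0,1\}$ discrete). The $\kappa$-closure of a subset $A$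 of a space $X$ is $cl_\kappa(A) = \bigcup\{\overline{B} : B \in [A]^{\le\kappa}\}$, where $\overline{B}$ is the closure of $B$ in $X$ and $[A]^{\le \kappa}$ is the set of subsets of $A$ of cardinality at most $\kappa$. For $x \in 2^\lambda$, $\operatorname{supp}(x) = \{\alpha<\lambda : x(\alpha) = 1\}$. A space (or subspace) $S$ is right separated if it has a well-ordering in which every initial segment is open in $S$; equivalently, $S$ is scattered (every nonempty subspace has an isolated point). *)

(* Defs.v *)
From mathcomp Require Import all_boot all_order.
From mathcomp Require Import all_classical wochoice.
From mathcomp Require Import topology.

Set Implicit Arguments.
Unset Strict Implicit.
Unset Printing Implicit Defensive.

Import Order.TTheory.

Local Open Scope order_scope.
Local Open Scope classical_set_scope.
Local Open Scope card_scope.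

(* Ordinals are well-ordered types and cardinals are initial ordinals. The
   ordinals below L are the elements x : L, the ordinal x itself being the
   initial segment [below x]. *)

Definition card_lt (T U : Type) (A : set T) (B : set U) : Prop :=
  A #<= B /\ ~ (B #<= A).

Definition below (d : Order.disp_t) (L : orderType d) (x : L) : set L :=
  [set y | y < x].

Definition is_ordinal (d : Order.disp_t) (L : orderType d) : Prop :=
  well_order (<=%O : rel L).

Definition is_cardinal (d : Order.disp_t) (L : orderType d) : Prop :=
  is_ordinal L /\ forall x : L, card_lt (below x) [set: L].

Definition cofinal (d : Order.disp_t) (L : orderType d) (A : set L) : Prop :=
  forall x : L, exists2 y : L, A y & x <= y.

Definition is_regular_cardinal (d : Order.disp_t) (L : orderType d) : Prop :=
  [/\ is_cardinal L, infinite_set [set: L] &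
      forall A : set L, cofinal A -> ~ card_lt A [set: L]].

(* The cardinal Kp is the successor |K|^+ of the cardinality of K. *)
Definition is_succ_cardinal (K : Type) (d : Order.disp_t) (Kp : orderType d) :
    Prop :=
  [/\ is_cardinal Kp, card_lt [set: K] [set: Kp] &
      forall (T : Type) (A : set T), card_lt [set: K] A -> [set: Kp] #<= A].

(* A has order type xi, and a i is the i-th member of A for every i < xi; the
   values a i for i >= xi are irrelevant. *)
Definition increasing_enum (dO dL : Order.disp_t) (O : orderType dO)
    (L : orderType dL) (xi : O) (A : set L) (a : O -> L) : Prop :=
  (forall i j : O, i < j -> j < xi -> a i < a j) /\ a @` below xi = A.

(* A colouring of [L]^2 is a c : set L -> bool, of which only the values at
   two-element sets matter; likewise only the values of h on xi * xi matter.
   Kp stands for the cardinal kappa^+, so that xi : Kp is an arbitrary ordinal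
   below kappa^+. *)
Definition witnesses_Col (dL dKp : Order.disp_t) (L : orderType dL)
    (Kp : orderType dKp) (c : set L -> bool) : Prop :=
  forall (xi : Kp) (h : Kp -> Kp -> bool)
    (A : L -> set L) (a : L -> Kp -> L),
    trivIset [set: L] A ->
    (forall alpha : L, increasing_enum xi (A alpha) (a alpha)) ->
    exists alpha beta : L, alpha < beta /\
      forall i j : Kp, i < xi -> j < xi ->
        c [set a alpha i; a beta j] = h i j.

Definition col_point (d : Order.disp_t) (L : orderType d) (c : set L -> bool)
    (alpha : L) : {ptws L -> bool} :=
  fun beta => if beta < alpha then c [set alpha; beta] else beta == alpha.

Definition F_ (d : Order.disp_t) (L : orderType d) (c : set L -> bool) :
    set {ptws L -> bool} :=
  range (col_point c).

Definition kappa_closure (K : Type) (X : topologicalType) (A : set X) : set X :=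
  \bigcup_(B in [set B | B `<=` A /\ B #<= [set: K]]) closure B.

Definition H_ (K : Type) (d : Order.disp_t) (L : orderType d)
    (c : set L -> bool) : set {ptws L -> bool} :=
  kappa_closure K (F_ c).

Definition supp (I : Type) (x : {ptws I -> bool}) : set I :=
  [set i | x i = true].

Definition initial_segment (X : Type) (R : rel X) (S I : set X) : Prop :=
  I `<=` S /\ forall x y : X, S x -> I y -> R x y -> I x.

Definition right_separated (X : topologicalType) (S : set X) : Prop :=
  exists R : rel X, wo_chain R (mem S) /\
    forall I : set X, initial_segment R S I -> open (I : set (subspace S)).

(* Main.v *)
Require Import Defs.
From mathcomp Require Import all_boot all_order.
From mathcomp Require Import all_classical wochoice.
From mathcomp Require Import topology.

(* Suppose the supports of the points of S are unbounded in L. Points of H have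
   bounded support, so cutting S at a minimal bad initial segment of its
   well-order R one may choose, for every eta < L, a point x_eta of S with a
   support element beyond eta whose R-predecessors have supports bounded by some
   b_eta. Then x_eta is a limit of points c_g with g in a set a_eta of size at
   most K, contained in [eta, L), and right separation gives a finite set d_eta
   such that every point of S agreeing with x_eta on d_eta is R-below x_eta.
   Thinning out by the regularity of L, the sets d_eta have a common root r, the
   x_eta agree on r, the sets A_eta = a_eta U (d_eta \ r) have a common order type
   and lie one after the other, and x_eta restricted to d_eta \ r has a common
   pattern in terms of positions in A_eta. Col applied to the A_eta and this
   pattern yields alpha < beta such that every c_g with g in a_beta, hence also
   x_beta, agrees with x_alpha on d_alpha \ r. So x_beta is R-below x_alpha, while
   its support is not bounded by b_alpha. *)

Set Implicit Arguments.
Unset Strict Implicit.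
Unset Printing Implicit Defensive.

Import Order.TTheory.

Local Open Scope order_scope.
Local Open Scope classical_set_scope.
Local Open Scope card_scope.

(** * Cardinal inequalities *)

Lemma card_le_inj (T U : Type) (u0 : U) (A : set T) (B : set U) :
  A #<= B -> exists2 f : T -> U, {in A &, injective f} & f @` A `<=` B.
Proof.
move=> /card_leP[g].
exists (fun x => if pselect (A x) is left Ax then val (g (SigSub (mem_set Ax)))
                 else u0).
  move=> x y; rewrite !inE => Ax Ay /=; case: pselect => // Ax'.
  case: pselect => // Ay' /val_inj gxy.
  have := @inj _ _ _ g _ _ (in_setT _) (in_setT _) gxy.
  by move/(congr1 val).
move=> _ [x Ax <-]; case: pselect => // Ax'.
exact/set_mem/valP.
Qed.

Lemma inj_on_card_le (T U : Type) (f : T -> U) (A : set T) (B : set U) :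
  {in A &, injective f} -> f @` A `<=` B -> A #<= B.
Proof.
move=> /inj_card_eq + /subset_card_le; rewrite card_eq_le => /andP[_].
exact: card_le_trans.
Qed.

Lemma card_lt_le_trans (T U V : Type) (A : set T) (B : set U) (C : set V) :
  A #<= B -> card_lt B C -> card_lt A C.
Proof.
move=> AB [BC CB]; split; first exact: card_le_trans BC.
by move=> CA; apply: CB; apply: card_le_trans AB.
Qed.

Lemma card_le_option (K : Type) :
  infinite_set [set: K] -> [set: option K] #<= [set: K].
Proof.
move=> /[dup] /infinite_setN0 [k0 _] /infiniteP /(card_le_inj k0)[i iI _].
have {}iI : injective i by move=> x y; apply: iI; rewrite inE.
(* [s] shifts the range of [i] one step and fixes everything else, so it is injective and misses
   [i 0], which becomes the image of [None]. *)
have /choice[s sP] k : exists k', (exists2 n, k = i n & k' = i n.+1) \/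
    (k' = k /\ forall n, k <> i n).
  have [[n ->]|ni] := pselect (exists n, k = i n).
    by exists (i n.+1); left; exists n.
  by exists k; right; split=> // n kn; apply: ni; exists n.
have s0 k : s k <> i 0.
  by case: (sP k) => [[n _ ->] /iI//|[-> /(_ 0)]].
have sI : injective s.
  move=> k l; case: (sP k) => [[n -> ->]|[-> kn]].
    by case: (sP l) => [[m -> -> /iI[->]]|[-> ln /esym/ln]].
  by case: (sP l) => [[m -> -> /kn]|[-> _]].
apply: (@inj_on_card_le _ _ (oapp s (i 0))) => //.
by case=> [k|] [l|] _ _ //= => [/sI->|/s0|/esym/s0].
Qed.

Lemma card_le_setU_seq (K : Type) (T : eqType) (A : set T) (s : seq T) :
  infinite_set [set: K] -> A #<= [set: K] ->
  A `|` [set` s] #<= [set: K].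
Proof.
move=> Kinf AK; have [k0 _] := infinite_setN0 Kinf.
elim: s => [|x s /(card_le_inj (k0))[f fI _]].
  by apply: card_le_trans AK; apply: subset_card_le => x [].
apply: card_le_trans (card_le_option Kinf).
apply: (@inj_on_card_le _ _ (fun y => if y == x then None else Some (f y))) => //.
move=> y z; rewrite !inE => yA zA; case: eqVneq => [->|yx].
  by case: eqVneq => [->|].
case: eqVneq => // zx [/fI]; apply; rewrite inE.
  by case: yA => [|/=]; rewrite ?inE ?(negPf yx); [left|right].
by case: zA => [|/=]; rewrite ?inE ?(negPf zx); [left|right].
Qed.

(** * Minima and recursion on well-ordered types *)

Lemma ordinal_min (d : Order.disp_t) (W : orderType d) (A : set W) :
  is_ordinal W -> A !=set0 -> exists2 m, A m & forall x, A x -> m <= x.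
Proof.
move=> Wwo [x Ax].
have [|m [[Am mmin] _]] := Wwo (mem A); first by exists x; rewrite inE.
by exists m => [|y Ay]; [rewrite inE in Am|apply: mmin; rewrite inE].
Qed.

Lemma ordinal_wf (d : Order.disp_t) (W : orderType d) :
  is_ordinal W -> well_founded (fun x y : W => x < y).
Proof.
move=> Wwo x; apply: contrapT => nx.
have [m nm mmin] := ordinal_min (A := [set y | ~ Acc (fun x y : W => x < y) y])
  Wwo (ex_intro _ x nx).
apply: nm; constructor=> y ym; apply: contrapT => /mmin.
by rewrite leNgt ym.
Qed.

(** Letting [F] see only the set of earlier values suffices both for increasing enumerations and for
    the thinning [t] in the main proof. *)
Lemma ordinal_rec (d : Order.disp_t) (W : orderType d) (V : Type)
    (F : set V -> V) :
  is_ordinal W -> exists t : W -> V, forall x, t x = F (t @` below x).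
Proof.
move=> /ordinal_wf wf.
pose G (x : W) (t : forall y, y < x -> V) := F [set v | exists y h, t y h = v].
exists (Fix wf (fun=> V) G) => x; rewrite Fix_eq; last first.
  move=> y f g fg; congr F; apply/seteqP; split=> v [z [h <-]]; exists z, h => //.
congr F; apply/seteqP; split=> v [y].
  by move=> [h <-]; exists y.
by move=> h <-; exists y, h.
Qed.

(** * Bounds, pigeonholes and finite roots at a regular cardinal *)

Section Regular.
Variables (d : Order.disp_t) (L : orderType d).
Hypothesis L_regular : is_regular_cardinal L.

Lemma regular_ordinal : is_ordinal L.
Proof. by have [[]] := L_regular. Qed.

Lemma regular_bound (T : Type) (D : set T) (f : T -> L) :
  card_lt D [set: L] -> exists b, forall x, D x -> f x < b.
Proof.
move=> DL; have [_ _ /(_ (f @` D)) nc] := L_regular.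
have /existsNP[b bP] : ~ cofinal (f @` D).
  by move/nc; apply; apply: card_lt_le_trans DL; exact: card_image_le.
exists b => x Dx; rewrite ltNge; apply/negP => bx; apply: bP.
by exists (f x) => //; exists x.
Qed.

Lemma regular_pigeonhole (V : Type) (f : L -> V) (A : set L) :
  cofinal A -> card_lt [set: V] [set: L] ->
  exists v, cofinal (A `&` [set x | f x = v]).
Proof.
move=> cA VL; apply: contrapT => /forallNP nc.
have /choice[g gP] v : exists b, forall x, A x -> f x = v -> x < b.
  have /existsNP[b bP] := nc v; exists b => x Ax fx; rewrite ltNge.
  by apply/negP => bx; apply: bP; exists x.
have [b bP] := regular_bound g VL; have [x Ax bx] := cA b.
by have := lt_trans (gP _ _ Ax erefl) (bP (f x) I); rewrite ltNge bx.
Qed.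

(** Fixing first the length and then the entries one by one avoids computing the cardinality of
    [seq V]. *)
Lemma regular_pigeonhole_seq (V : Type) (f : L -> seq V) (A : set L) :
  card_lt [set: nat] [set: L] -> cofinal A -> card_lt [set: V] [set: L] ->
  exists s, cofinal (A `&` [set x | f x = s]).
Proof.
move=> natL cA VL.
have [n] := regular_pigeonhole (size \o f) cA natL.
elim: n f A {cA} => [|n IH] f A cB.
  by exists [::] => x; have [y [Ay /size0nil fy] xy] := cB x; exists y.
have [_ /infinite_setN0[x0 _] _] := L_regular.
have [v0 _] : [set: V] !=set0.
  by have [y [_ /=]] := cB x0; case: (f y) => // v _ _ _; exists v.
have [v cv] := regular_pigeonhole (head v0 \o f) cB VL.
set B := _ `&` _ in cv.
have [|s cs] := IH (behead \o f) B.
  move=> x; have [y [[Ay fy] fv] xy] := cv x; exists y => //.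
  by split=> //=; rewrite size_behead [size _]fy.
exists (v :: s) => x; have [y [[[Ay fy] fv] fs] xy] := cs x; exists y => //.
by split=> //=; move: fy fv fs => /=; case: (f y) => //= ? ? _ -> ->.
Qed.


(* A maximal r contained in cofinally many of the s x works: each further
   element lies in boundedly many of these, and L is regular. *)
Lemma regular_root (s : L -> seq L) (A : set L) :
  card_lt [set: nat] [set: L] -> cofinal A ->
  exists (r : seq L) (B : set L), [/\ B `<=` A, cofinal B,
    forall x, B x -> {subset r <= s x} &
    forall g, exists b, forall x, B x -> b <= x ->
      forall y, y \in s x -> y < g -> y \in r].
Proof.
move=> natL cA; have [n cB] := regular_pigeonhole (size \o s) cA natL.
set B := A `&` _ in cB.
pose P k := `[< exists r, [/\ uniq r, size r = k &
  cofinal (B `&` [set x | {subset r <= s x}])] >].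
have exP : exists k, P k.
  exists 0; apply/asboolP; exists [::]; split=> // x.
  by have [y By xy] := cB x; exists y.
have [_ /infinite_setN0[x0 _] _] := L_regular.
have ubP k : P k -> (k <= n)%N.
  move=> /asboolP[r [ur <- /(_ x0)[y [[_ <-] ry] _]]].
  exact: uniq_leq_size.
case: (ex_maxnP exP ubP) => k /asboolP[r [ur sr cr]] kmax.
have bd z : exists b, z \notin r -> forall x, B x -> {subset r <= s x} ->
    z \in s x -> x < b.
  have [zr|zr] := boolP (z \in r); first by exists x0.
  apply: contrapT => nb; have : P k.+1; last by move/kmax; rewrite ltnn.
  apply/asboolP; exists (z :: r); split; rewrite /= ?zr ?sr // => x.
  apply: contrapT => nx; apply: nb; exists x => _ y By ry zy.
  rewrite ltNge; apply/negP => xy; apply: nx; exists y => //; split=> //.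
  by move=> u; rewrite inE => /predU1P[->//|/ry].
have /choice[e eP] := bd.
exists r, (B `&` [set x | {subset r <= s x}]); split=> //.
- by move=> x [[]].
- by move=> x [].
move=> g; have [[_ /(_ g) ltg] _ _] := L_regular.
have [b bP] := regular_bound e ltg.
exists b => x [Bx rx] bx y yx /bP yb; apply: contraT => /eP /(_ x Bx rx yx) xe.
by have := lt_trans xe yb; rewrite ltNge bx.
Qed.

End Regular.

(** Recursively take the least element of [A] not taken yet. This must stop at some [xi] in [O], or
    else [a] would inject [O] into [A]. *)
Lemma card_lt_increasing_enum (dO dL : Order.disp_t) (O : orderType dO)
    (L : orderType dL) (x0 : L) (A : set L) :
  is_ordinal O -> is_ordinal L -> ~ ([set: O] #<= A) ->
  exists (xi : O) (a : O -> L), increasing_enum xi A a.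
Proof.
move=> Owo Lwo OA.
have /choice[F FP] (B : set L) : exists m, A `\` B !=set0 ->
    (A `\` B) m /\ forall x, A x -> ~ B x -> m <= x.
  have [/(ordinal_min Lwo)[m Bm mP]|] := pselect (A `\` B !=set0).
    by exists m => _; split=> // x Ax Bx; apply: mP.
  by exists x0.
have [a aE] := ordinal_rec F Owo.
pose N i := A `\` a @` below i !=set0.
have aN i : N i -> (A (a i) /\ forall j, j < i -> a j <> a i) /\
    forall x, A x -> ~ (a @` below i) x -> a i <= x.
  move=> /FP; rewrite -aE => -[[Aai ni] ai]; split=> //; split=> // j ji ajE.
  by apply: ni; exists j.
have [xi nxi xiP] : exists2 xi, ~ N xi & forall i, ~ N i -> xi <= i.
  apply: (ordinal_min (A := [set i | ~ N i])) => //; apply: contrapT => nN.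
  have {}nN i : N i by apply: contrapT => ni; apply: nN; exists i.
  apply: OA; apply: (@inj_on_card_le _ _ a).
    move=> i j _ _ aij; case: (ltgtP i j) => // ij.
      by have [[_ /(_ _ ij)]] := aN j (nN j).
    by have [[_ /(_ _ ij)]] := aN i (nN i); rewrite aij.
  by move=> _ [i _ <-]; have [[]] := aN i (nN i).
have {}xiP i : i < xi -> N i.
  by move=> ixi; apply: contrapT => /xiP; rewrite leNgt ixi.
have aA i : i < xi -> A (a i) by move=> /xiP /aN[[]].
exists xi, a; split.
  move=> i j ij jxi; have [[_ ajN] _] := aN _ (xiP _ jxi).
  have [_ aimin] := aN _ (xiP _ (lt_trans ij jxi)).
  rewrite lt_neqAle; apply/andP; split; first exact/eqP/ajN.
  by apply: aimin (aA _ jxi) _ => -[k ki]; apply: ajN (lt_trans ki ij).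
apply/seteqP; split=> [_ [i ixi <-]|x Ax]; first exact: aA.
by apply: contrapT => nx; apply: nxi; exists x.
Qed.

(** * Neighbourhoods in the Cantor cube and right separation *)

Lemma nbhs_ptws_bool (I : eqType) (x : {ptws I -> bool})
    (U : set {ptws I -> bool}) :
  nbhs x U -> exists s : seq I, forall z : {ptws I -> bool},
    {in s, forall i, z i = x i} -> U z.
Proof.
pose F : set_system {ptws I -> bool} := filter_from [set: seq I]
  (fun s => [set z | {in s, forall i, z i = x i}]).
have FF : Filter F.
  apply: filter_from_filter; first by exists [::].
  move=> s t _ _; exists (s ++ t) => // z zx; split=> i ix; apply: zx;
    by rewrite mem_cat ix ?orbT.
(* The product topology is a supremum, so convergence is checked one coordinate at a time. *)
have Fx : F --> x.
  apply/cvg_sup => i V [_ [[W oW <-] /= Wxi WV]].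
  exists [:: i] => // z zx; apply: WV => /=.
  by rewrite zx ?mem_head.
by move=> /Fx[s _ sU]; exists s => z /sU.
Qed.

Lemma nbhs_ptws_coord (I : eqType) (x : {ptws I -> bool}) (i : I) :
  nbhs x [set z : {ptws I -> bool} | z i = x i].
Proof.
apply: (@proj_continuous _ (fun=> bool) i x [set b | b = x i]).
exact: discrete_set1.
Qed.

Lemma wo_chain_min (X : eqType) (R : rel X) (S A : set X) :
  wo_chain R (mem S) -> A `<=` S -> A !=set0 ->
  exists2 m, A m & forall y, A y -> R m y.
Proof.
move=> Rwo AS [x Ax]; have [||m [[Am mmin] _]] := Rwo (mem A).
- by move=> y; rewrite /= !inE; exact: AS.
- by exists x; rewrite inE.
by exists m => [|y Ay]; [rewrite inE in Am|apply: mmin; rewrite inE].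
Qed.

(** Compare with the least element of the three: unless it is [x], antisymmetry identifies two
    neighbours in the chain. *)
Lemma wo_chain_trans (X : eqType) (R : rel X) (S : set X) (x y z : X) :
  wo_chain R (mem S) -> S x -> S y -> S z -> R x y -> R y z -> R x z.
Proof.
move=> Rwo Sx Sy Sz xy yz.
have anti u v : S u -> S v -> R u v -> R v u -> u = v.
  move=> Su Sv uv vu; apply: (wo_chain_antisymmetric Rwo); rewrite ?inE //.
  by rewrite uv vu.
have [m mxyz mmin] := wo_chain_min (A := [set x; y; z]) Rwo
  (ltac:(by move=> _ [[]|] ->)) (ex_intro _ x (or_introl (or_introl erefl))).
have mx : R m x by apply: mmin; left; left.
have my : R m y by apply: mmin; left; right.
have mz : R m z by apply: mmin; right.
case: mxyz mx my mz => [[->|->]|->] mx my mz //.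
  by rewrite (anti x y).
by rewrite -(anti y z).
Qed.

Lemma right_separated_nbhs (X : topologicalType) (R : rel X) (S : set X) :
  wo_chain R (mem S) ->
  (forall I : set X, initial_segment R S I -> open (I : set (subspace S))) ->
  forall x, S x -> exists2 U, nbhs x U & forall z, U z -> S z -> R z x.
Proof.
move=> Rwo Rop x Sx; pose I := [set z | S z /\ R z x].
have Rx : R x x by apply: (wo_chain_reflexive Rwo); rewrite inE.
have /Rop/open_subspaceP[U oU UE] : initial_segment R S I.
  split=> [z []//|z y Sz [Sy yx] zy]; split=> //.
  exact: (wo_chain_trans Rwo) zy yx.
exists U.
  apply: open_nbhs_nbhs; split=> //.
  by have [] : (U `&` S) x by rewrite UE.
by move=> z Uz Sz; have [[]] : (I `&` S) z by rewrite -UE.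
Qed.

(** * The points of F[c] and their closures *)

Section ColPoint.
Variables (d : Order.disp_t) (L : orderType d) (c : set L -> bool).

Lemma col_point_supp (g i : L) : col_point c g i = true -> i <= g.
Proof. by rewrite /col_point; case: ltP => [/ltW|_ /eqP->]. Qed.

Lemma H_closure_col_point (K : Type) (x : {ptws L -> bool}) : H_ K c x ->
  exists2 a : set L, a #<= [set: K] & closure (col_point c @` a) x.
Proof.
move=> [B [BF BK] Bx].
have [[y0 By0]|B0] := pselect (B !=set0); last first.
  by have [z [Bz _]] := Bx setT filterT; case: B0; exists z.
have [g0 _ _] := BF _ By0.
have /choice[g gP] z : exists g, B z -> col_point c g = z.
  have [/BF[g _ gz]|nBz] := pselect (B z); first by exists g.
  by exists g0.
exists (g @` B); first exact: card_le_trans (card_image_le _ _) BK.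
move=> U /Bx[z [Bz Uz]]; exists z; split=> //.
by exists (g z); [exists z|exact: gP].
Qed.

Lemma closure_col_point_coord (a : set L) (x : {ptws L -> bool}) (i : L) :
  closure (col_point c @` a) x -> exists2 g, a g & col_point c g i = x i.
Proof.
by move=> /(_ _ (nbhs_ptws_coord x i))[_ [[g ag <-] /= gi]]; exists g.
Qed.

(** Having value true at [i] is a neighbourhood of [x], and the points of F[c] inside it have index
    at least [i]. *)
Lemma closure_col_point_tail (a : set L) (x : {ptws L -> bool}) (i : L) :
  closure (col_point c @` a) x -> x i = true ->
  closure (col_point c @` (a `&` [set g | i <= g])) x.
Proof.
move=> ax xi U xU.
have [_ [[g ag <-] [Ug /= gi]]] := ax _ (filterI xU (nbhs_ptws_coord x i)).
exists (col_point c g); split=> //; exists g => //; split=> //=.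
by apply: col_point_supp; rewrite gi.
Qed.

End ColPoint.

Theorem theorem2p4 (K : Type) (dKp dL : Order.disp_t)
    (Kp : orderType dKp) (L : orderType dL)
    (K_infinite : infinite_set [set: K])
    (Kp_succ : is_succ_cardinal K Kp)
    (L_regular : is_regular_cardinal L)
    (L_gt : card_lt [set: Kp] [set: L])
    (c : set L -> bool)
    (c_Col : witnesses_Col Kp c)
    (S : set {ptws L -> bool})
    (S_sub : S `<=` H_ K c)
    (S_rsep : right_separated S) :
  exists alpha : L, \bigcup_(x in S) supp x `<=` below alpha.
Proof.
have [[Kp_wo _] [KKp KpK] _] := Kp_succ.
have L_wo := regular_ordinal L_regular.
have KL : card_lt [set: K] [set: L] by exact: card_lt_le_trans L_gt.
have natL : card_lt [set: nat] [set: L].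
  by apply: card_lt_le_trans KL; exact/infiniteP.
have [_ /infinite_setN0[l0 _] L_low] := L_regular.
have [R [Rwo Rop]] := S_rsep.
have Rrefl x : S x -> R x x.
  by move=> Sx; apply: (wo_chain_reflexive Rwo); rewrite inE.
apply: contrapT => Snb.
have unb b : exists x i, [/\ S x, x i = true & b <= i].
  apply: contrapT => nb; apply: Snb; exists b => i [x Sx xi].
  by rewrite /below/= ltNge; apply/negP => bi; apply: nb; exists x, i.
pose P (y : {ptws L -> bool}) :=
  forall b, exists z i, [/\ S z, R z y, z i = true & b <= i].
have supp_bound (x : {ptws L -> bool}) :
    S x -> exists b, forall i, x i = true -> i < b.
  move=> /S_sub/H_closure_col_point[a aK ax].
  have [b bP] := regular_bound L_regular id (card_lt_le_trans aK KL).
  exists b => i xi; have [g /bP gb gi] := closure_col_point_coord i ax.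
  by apply: le_lt_trans gb; apply: (@col_point_supp _ _ c); rewrite gi.
(* If [P] holds somewhere on [S], let [m] be the [R]-least such point and take [z] below it with a
   support element beyond both [eta] and the support of [m]. Then [z] differs from [m], so [P z]
   fails by minimality. *)
have /choice[x /choice[u xuP]] eta :
    exists x i, [/\ S x, ~ P x, x i = true & eta <= i].
  have [[y0 [Sy0 Py0]]|nP] := pselect (exists y, S y /\ P y); last first.
    have [x [i [Sx xi ei]]] := unb eta; exists x, i; split=> // Px.
    by apply: nP; exists x.
  have [m [Sm Pm] mmin] : exists2 m, S m /\ P m & forall y, S y /\ P y -> R m y.
    by apply: (wo_chain_min (A := [set y | S y /\ P y]) Rwo) => [y []|] //; exists y0.
  have [b bP] := supp_bound _ Sm.
  have [z [i [Sz zm zi bi]]] := Pm (Order.max eta b).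
  move: bi; rewrite ge_max => /andP[ei bi]; exists z, i; split=> // Pz.
  suff zE : z = m by have := bP i; rewrite -zE ltNge bi => /(_ zi).
  by apply: (wo_chain_antisymmetric Rwo); rewrite ?inE // zm mmin.
have Sx eta : S (x eta) by case: (xuP eta).
have /choice[a aP] eta : exists a : set L, [/\ a #<= [set: K],
    forall g, a g -> eta <= g & closure (col_point c @` a) (x eta)].
  have [/S_sub/H_closure_col_point[a aK ax] _ xu eu] := xuP eta.
  exists (a `&` [set g | u eta <= g]); split.
  - by apply: card_le_trans aK; apply: subset_card_le => g [].
  - by move=> g [_]; exact: le_trans.
  - exact: closure_col_point_tail.
have /choice[d dP] eta : exists d : seq L, forall z : {ptws L -> bool},
    {in d, forall i, z i = x eta i} -> S z -> R z (x eta).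
  have [U xU UP] := right_separated_nbhs Rwo Rop (Sx eta).
  by have [d dP] := nbhs_ptws_bool xU; exists d => z /dP; exact: UP.
have adK eta : a eta `|` [set` d eta] #<= [set: K].
  by apply: card_le_setU_seq => //; have [] := aP eta.
have /choice[b bP] eta : exists b,
    (forall i, (a eta `|` [set` d eta]) i -> i < b) /\
    forall z i, S z -> R z (x eta) -> z i = true -> i < b.
  have [b1 b1P] := regular_bound L_regular id (card_lt_le_trans (adK eta) KL).
  (* [b2] comes from the failure of [P (x eta)]. *)
  have [_ /existsNP[b2 b2P] _ _] := xuP eta.
  exists (Order.max b1 b2); split=> [i /b1P ib|z i Sz zx zi].
    by rewrite lt_max ib.
  rewrite lt_max; apply/orP; right; rewrite ltNge; apply/negP => bi.
  by apply: b2P; exists z, i.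
have cofT : cofinal [set: L] by move=> l; exists l.
have [r [B1 [_ cB1 rd rP]]] := regular_root L_regular d natL cofT.
(* There are only countably many lists of booleans. *)
have [w cB2] := regular_pigeonhole L_regular (fun eta => map (x eta) r) cB1
  (card_lt_le_trans (countableP _) natL).
set B2 := _ `&` _ in cB2.
pose D eta := [seq y <- d eta | y \notin r].
pose A eta := a eta `|` [set` D eta].
have /choice[xi /choice[e eP]] eta :
    exists (xi : Kp) (e : Kp -> L), increasing_enum xi (A eta) e.
  apply: card_lt_increasing_enum => // KpA; apply: KpK.
  apply: card_le_trans KpA _; apply: card_le_trans (adK eta).
  apply: subset_card_le => y [ay|]; first by left.
  by rewrite /= mem_filter => /andP[_ yd]; right.
(* The finite list of positions where [x eta] is true codes its pattern on [D eta]. Functions on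
   [Kp] could be too numerous for the pigeonhole principle; finite lists are not. *)
have /choice[q qP] eta : exists q : seq Kp, forall i, i < xi eta ->
    e eta i \in D eta -> (i \in q) = x eta (e eta i).
  have [einc eA] := eP eta.
  have einj i j : i < xi eta -> j < xi eta -> e eta i = e eta j -> i = j.
    by move=> ix jx eij; case: (ltgtP i j) => // ij;
      have := einc _ _ ij; rewrite eij ltxx; [move=> /(_ jx)|move=> /(_ ix)].
  have /choice[pos posP] y : exists i, y \in D eta -> i < xi eta /\ e eta i = y.
    have [yD|] := boolP (y \in D eta); last by exists (xi eta).
    have : A eta y by right.
    by rewrite -eA => -[i ix <-]; exists i.
  exists [seq pos y | y <- D eta & x eta y] => i ix iD; apply/mapP/idP.
    move=> [y]; rewrite mem_filter => /andP[xy /posP[_ ey]] iE.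
    by rewrite iE ey.
  move=> xe; exists (e eta i); first by rewrite mem_filter xe.
  by have [px pe] := posP _ iD; exact/esym/einj.
have [xi0 cB3] := regular_pigeonhole L_regular xi cB2 L_gt.
have [q0 cB4] := regular_pigeonhole_seq L_regular q natL cB3 L_gt.
set B4 := _ `&` _ in cB4.
(* Beyond the bound given by [rP l], any element of [d eta] below [l] lies in the root, so [D eta]
   stays above [l]. *)
have /choice[pick pickP] l : exists eta, [/\ B4 eta, l <= eta &
    forall y, A eta y -> l <= y].
  have [b0 b0P] := rP l; have [eta Beta] := cB4 (Order.max l b0).
  rewrite ge_max => /andP[leta b0eta]; exists eta; split=> // y [ay|].
    by apply: le_trans leta _; have [_ aeta _] := aP eta; exact: aeta.
  rewrite /= mem_filter => /andP[yr yd]; rewrite leNgt; apply/negP => yl.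
  have [[[B1eta _] _] _] := Beta.
  by rewrite (b0P _ B1eta b0eta _ yd yl) in yr.
(* The default [l0] makes [U] total; the recursion only meets the small sets of values of [t] on
   initial segments. *)
have /choice[U UP] (V : set L) : exists l, card_lt V [set: L] ->
    forall v, V v -> b v < l.
  have [VL|] := pselect (card_lt V [set: L]); last by exists l0.
  by have [l lP] := regular_bound L_regular b VL; exists l.
have [t tE] := ordinal_rec (pick \o U) L_wo.
have tB l : B4 (t l) by rewrite tE /=; have [] := pickP (U (t @` below l)).
have tsep l m : l < m -> exists v, [/\ b (t l) < v, v <= t m &
    forall y, A (t m) y -> v <= y].
  move=> lm; exists (U (t @` below m)).
  have [_ ? ?] := pickP (U (t @` below m)); rewrite [t m]tE; split=> //.
  apply: UP; last by exists l.
  have [[_ /(_ m)]] := L_regular; move=> + _ _; apply: card_lt_le_trans.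
  exact: card_image_le.
have Ab eta y : A eta y -> y < b eta.
  have [bP1 _] := bP eta; move=> Ay; apply: bP1.
  case: Ay => [ay|]; first by left.
  by rewrite /= mem_filter => /andP[_ yd]; right.
have tA : trivIset [set: L] (A \o t).
  move=> l m _ _ [y [ly my]].
  case: (ltgtP l m) => // /tsep[v [bv _ vA]].
    by have := lt_trans (Ab _ _ ly) bv; rewrite ltNge vA.
  by have := lt_trans (Ab _ _ my) bv; rewrite ltNge vA.
have tenum l : increasing_enum xi0 ((A \o t) l) (e (t l)).
  by have [[_ <-] _] := tB l; exact: eP.
(* The prescribed colour ignores [j], so all indices in [a (t m)] give the same value at a given
   position of the lower set. *)
have [l [m [lm colP]]] := c_Col xi0 (fun i j => i \in q0) _ _ tA tenum.
have [v [bv vt vA]] := tsep _ _ lm.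
have [[[Bl wl] xil] ql] := tB l; have [[[Bm wm] xim] qm] := tB m.
(* Agreement puts [x (t m)] [R]-below [x (t l)], but its support element [u (t m)] is at least
   [t m], hence above [b (t l)]. *)
suff /dP /(_ (Sx _)) xml : {in d (t l), forall i, x (t m) i = x (t l) i}.
  have [_ _ xu tu] := xuP (t m).
  have := (bP (t l)).2 _ _ (Sx _) xml xu.
  by rewrite ltNge (le_trans (ltW bv)) // (le_trans vt).
move=> y yd; have [yr|yr] := boolP (y \in r).
  by move: y yr {yd}; apply/eq_in_map; rewrite [LHS]wm.
have yD : y \in D (t l) by rewrite mem_filter yr.
have [einc eA] := eP (t l).
have [i ixi yE] : (e (t l) @` below (xi (t l))) y by rewrite eA; right.
have [_ _ /(closure_col_point_coord y)[g ag <-]] := aP (t m).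
have Ag : A (t m) g by left.
have [_ em] := eP (t m).
have [j jxi gE] : (e (t m) @` below (xi (t m))) g by rewrite em.
have yg : y < g.
  by apply: lt_le_trans (vA _ Ag); apply: lt_trans bv; apply: Ab; right.
(* As [y < g], the value at [y] is the colour of the pair; [setUC] puts the element of the lower set
   first, as in [colP]. *)
rewrite /col_point yg -gE setUC -[in LHS]yE colP; last 2 first.
- by rewrite -xil.
- by rewrite -xim.
by rewrite -ql qP ?yE.
Qed.
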